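(* If $\mathcal{G}$ is provable in $\mathsf{LNGL}$, then $\mathcal{G}$ is valid.
   Context: Formulae are built from propositional atoms $p$ by $\neg$, $\lor$, $\Box$; a formula is valid iff it holds at every world of every Kripke model whose accessibility relation is transitive and conversely wellfounded (Gödel–Löb logic $\mathsf{GL}$). A linear nested sequent is an expression $\mathcal{G} = \Gamma_{1} \vdash \Delta_{1} \mathbin{/\!/} \cdots \mathbin{/\!/} \Gamma_{n} \vdash \Delta_{n}$ with $\Gamma_i,\Delta_i$ finite multisets of formulae. Its formula interpretation is $f(\Gamma \vdash \Delta) := \bigwedge \Gamma \rightarrow \bigvee \Delta$ and $f(\Gamma \vdash \Delta \mathbin{/\!/} \mathcal{G}) := \bigwedge \Gamma \rightarrow (\bigvee \Delta \lor \Box f(\mathcal{G}))$; $\mathcal{G}$ is valid iff $f(\mathcal{G})$ is valid. The calculus $\mathsf{LNGL}$ has the following rules, where $\mathcal{G}$ denotes a (possibly empty) initial segment of a linear nested sequent: initial sequents $\mathsf{id_1}$: $\mathcal{G} \mathbin{/\!/} \Gamma, p \vdash p, \Delta$ and $\mathsf{id_2}$: $\mathcal{G} \mathbin{/\!/} \Gamma, \Box\phi \vdash \Box\phi, \Delta$; $\lor\mathsf{L}$: from $\mathcal{G} \mathbin{/\!/} \Gamma, \phi \vdash \Delta$ and $\mathcal{G} \mathbin{/\!/} \Gamma, \psi \vdash \Delta$ infer $\mathcal{G} \mathbin{/\!/} \Gamma, \phi\lor\psi \vdash \Delta$; $\lor\mathsf{R}$: from $\mathcal{G} \mathbin{/\!/}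 \Gamma \vdash \phi,\psi,\Delta$ infer $\mathcal{G} \mathbin{/\!/} \Gamma \vdash \phi\lor\psi,\Delta$; $\neg\mathsf{L}$: from $\mathcal{G} \mathbin{/\!/} \Gamma \vdash \phi,\Delta$ infer $\mathcal{G} \mathbin{/\!/} \Gamma,\neg\phi \vdash \Delta$; $\neg\mathsf{R}$: from $\mathcal{G} \mathbin{/\!/} \Gamma,\phi \vdash \Delta$ infer $\mathcal{G} \mathbin{/\!/} \Gamma \vdash \neg\phi,\Delta$; $\mathsf{4L}$: from $\mathcal{G} \mathbin{/\!/} \Gamma,\Box\phi \vdash \Delta \mathbin{/\!/} \Sigma,\Box\phi \vdash \Pi$ infer $\mathcal{G} \mathbin{/\!/} \Gamma,\Box\phi \vdash \Delta \mathbin{/\!/} \Sigma \vdash \Pi$; $\Box\mathsf{L}$: from $\mathcal{G} \mathbin{/\!/} \Gamma,\Box\phi \vdash \Delta \mathbin{/\!/} \Sigma,\phi \vdash \Pi$ infer $\mathcal{G} \mathbin{/\!/} \Gamma,\Box\phi \vdash \Delta \mathbin{/\!/} \Sigma \vdash \Pi$; $\Box\mathsf{R}$: from $\mathcal{G} \mathbin{/\!/} \Gamma \vdash \Delta \mathbin{/\!/} \Box\phi \vdash \phi$ infer $\mathcal{G} \mathbin{/\!/} \Gamma \vdash \Box\phi,\Delta$. *)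

(* Defs.v *)
From HB Require Import structures.
From mathcomp Require Import all_boot.
From mathcomp Require Import finmap multiset.

Set Implicit Arguments.
Unset Strict Implicit.
Unset Printing Implicit Defensive.

Declare Scope gl_scope.
Delimit Scope gl_scope with gl.
Local Open Scope mset_scope.

Inductive form : Type :=
| Atom of nat
| Neg of form
| Or of form & form
| Box of form.

(* Finite multisets {mset form} need a choiceType on formulae; it is transported
   from mathcomp's generic trees. *)
Fixpoint tree_of_form (a : form) : GenTree.tree nat :=
  match a with
  | Atom p => GenTree.Leaf p
  | Neg b => GenTree.Node 0 [:: tree_of_form b]
  | Or b c => GenTree.Node 1 [:: tree_of_form b; tree_of_form c]
  | Box b => GenTree.Node 2 [:: tree_of_form b]
  end.

Fixpoint form_of_tree (t : GenTree.tree nat) : option form :=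
  match t with
  | GenTree.Leaf p => Some (Atom p)
  | GenTree.Node 0 [:: t1] => omap Neg (form_of_tree t1)
  | GenTree.Node 1 [:: t1; t2] =>
      if form_of_tree t1 is Some a then omap (Or a) (form_of_tree t2) else None
  | GenTree.Node 2 [:: t1] => omap Box (form_of_tree t1)
  | _ => None
  end.

Lemma tree_of_formK : pcancel tree_of_form form_of_tree.
Proof. by elim=> [p|a /= ->|a /= -> b /= ->|a /= ->]. Qed.

HB.instance Definition _ := Countable.copy form (pcan_type tree_of_formK).

Definition Imp (a b : form) : form := Or (Neg a) b.
Definition And (a b : form) : form := Neg (Or (Neg a) (Neg b)).
Definition Top : form := Or (Atom 0) (Neg (Atom 0)).
Definition Bot : form := Neg Top.

Definition bigAnd (s : seq form) : form := foldr And Top s.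
Definition bigOr (s : seq form) : form := foldr Or Bot s.

Record model : Type := Model {
  world : Type;
  acc : world -> world -> Prop;
  val_atom : nat -> world -> Prop
}.

Fixpoint holds (M : model) (w : world M) (a : form) : Prop :=
  match a with
  | Atom p => val_atom p w
  | Neg b => ~ holds w b
  | Or b c => holds w b \/ holds w c
  | Box b => forall v : world M, acc w v -> holds v b
  end.

Definition transitive_model (M : model) : Prop :=
  forall u v w : world M, acc u v -> acc v w -> acc u w.

Definition conversely_wellfounded (M : model) : Prop :=
  well_founded (fun v w : world M => acc w v).

Definition valid (a : form) : Prop :=
  forall M : model, transitive_model M -> conversely_wellfounded M ->
  forall w : world M, holds w a.

Record sequent : Type := Sequent {
  ante : {mset form};
  succ : {mset form}
}.

Notation "G ⊢ D" := (Sequent G%mset D%mset) (at level 80, no associativity) : gl_scope.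

Inductive lns : Type :=
| LOne of sequent
| LCons of sequent & lns.

(* [G // H] for a possibly empty initial segment G, given as the list of its
   components. *)
Definition after (G : seq sequent) (H : lns) : lns := foldr LCons H G.

Fixpoint interp (G : lns) : form :=
  match G with
  | LOne s => Imp (bigAnd (ante s)) (bigOr (succ s))
  | LCons s H => Imp (bigAnd (ante s)) (Or (bigOr (succ s)) (Box (interp H)))
  end.

Definition lns_valid (G : lns) : Prop := valid (interp G).

Local Open Scope gl_scope.

Implicit Types (G : seq sequent) (Ga De Si Pi : {mset form}) (a b : form).

Inductive LNGL : lns -> Prop :=
| id1 G Ga De p :
    LNGL (after G (LOne (Atom p +` Ga ⊢ Atom p +` De)))
| id2 G Ga De a :
    LNGL (after G (LOne (Box a +` Ga ⊢ Box a +` De)))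
| orL G Ga De a b :
    LNGL (after G (LOne (a +` Ga ⊢ De))) ->
    LNGL (after G (LOne (b +` Ga ⊢ De))) ->
    LNGL (after G (LOne (Or a b +` Ga ⊢ De)))
| orR G Ga De a b :
    LNGL (after G (LOne (Ga ⊢ a +` (b +` De)))) ->
    LNGL (after G (LOne (Ga ⊢ Or a b +` De)))
| negL G Ga De a :
    LNGL (after G (LOne (Ga ⊢ a +` De))) ->
    LNGL (after G (LOne (Neg a +` Ga ⊢ De)))
| negR G Ga De a :
    LNGL (after G (LOne (a +` Ga ⊢ De))) ->
    LNGL (after G (LOne (Ga ⊢ Neg a +` De)))
| fourL G Ga De Si Pi a :
    LNGL (after G (LCons (Box a +` Ga ⊢ De) (LOne (Box a +` Si ⊢ Pi)))) ->
    LNGL (after G (LCons (Box a +` Ga ⊢ De) (LOne (Si ⊢ Pi))))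
| boxL G Ga De Si Pi a :
    LNGL (after G (LCons (Box a +` Ga ⊢ De) (LOne (a +` Si ⊢ Pi)))) ->
    LNGL (after G (LCons (Box a +` Ga ⊢ De) (LOne (Si ⊢ Pi))))
| boxR G Ga De a :
    LNGL (after G (LCons (Ga ⊢ De) (LOne ([mset Box a] ⊢ [mset a])))) ->
    LNGL (after G (LOne (Ga ⊢ Box a +` De))).

(* Main.v *)
From Stdlib Require Import Classical.
From mathcomp Require Import all_boot.
From mathcomp Require Import finmap multiset.
Require Import Defs.

(* Every rule is sound locally: in a transitive, conversely wellfounded model,
   if the premises hold at a world then so does the conclusion. For [boxR] this
   is Löb's principle, Box (Box a -> a) -> Box a, obtained by wellfounded
   induction on the successors of the world. Local soundness passes under an
   initial segment because the interpretation is monotone in its last part. *)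

Set Implicit Arguments.
Unset Strict Implicit.
Unset Printing Implicit Defensive.

Local Open Scope mset_scope.
Local Open Scope gl_scope.

Section Semantics.

Variable M : model.

Implicit Types (w v : world M) (A B : {mset form}) (a b : form) (H K L : lns).

Definition holds_all w A : Prop := forall a, a \in A -> holds w a.
Definition holds_some w A : Prop := exists2 a, a \in A & holds w a.

(** A direct semantic reading of [interp], stated through multiset membership, so that each rule can
    be checked without unfolding the encoded connectives. *)
Fixpoint holds_lns w H : Prop :=
  match H with
  | LOne s => holds_all w (ante s) -> holds_some w (succ s)
  | LCons s K => holds_all w (ante s) ->
      holds_some w (succ s) \/ forall v, acc w v -> holds_lns v K
  end.

(** Classical reasoning enters because conjunction is encoded by [Neg] and [Or], and [Top] is an
    instance of excluded middle. *)
Lemma holds_bigAnd w (s : seq form) :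
  holds w (bigAnd s) <-> forall a, a \in s -> holds w a.
Proof.
elim: s => [|a s IHs] /=; first by split=> // _; apply: classic.
split=> [nAs b|As].
  rewrite inE => /predU1P[->|]; first by apply: NNPP => na; apply: nAs; left.
  by apply: IHs.1; apply: NNPP => ns; apply: nAs; right.
by case; apply; [apply: As | apply/IHs => b sb; apply: As]; rewrite inE ?eqxx ?sb ?orbT.
Qed.

Lemma holds_bigOr w (s : seq form) :
  holds w (bigOr s) <-> exists2 a, a \in s & holds w a.
Proof.
elim: s => [|a s IHs] /=; first by split=> [[]|[]//]; apply: classic.
split=> [[wa|/IHs[b sb wb]]|[b]].
- by exists a; rewrite ?mem_head.
- by exists b; rewrite // inE sb orbT.
- by rewrite inE => /predU1P[->|sb] wb; [left | right; apply/IHs; exists b].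
Qed.

Lemma holds_Imp w a b : holds w (Imp a b) <-> (holds w a -> holds w b).
Proof.
split=> [[na /na|wb _] //|wab].
by case: (classic (holds w a)) => [/wab|]; [right | left].
Qed.

Lemma holds_interp w H : holds w (interp H) <-> holds_lns w H.
Proof.
elim: H w => [[A B]|[A B] H IHH] w; rewrite /interp -/interp holds_Imp holds_bigAnd.
  by rewrite holds_bigOr.
rewrite [holds _ _]/= holds_bigOr /=.
by split=> h /h[wB|hH]; [left | right=> v /hH /IHH | left | right=> v /hH /IHH].
Qed.

Lemma holds_all_cons w a A : holds_all w (a +` A) <-> holds w a /\ holds_all w A.
Proof.
split=> [wA|[wa wA] b]; last by rewrite in_mset1D => /predU1P[->|/wA].
by split=> [|b Ab]; apply: wA; rewrite in_mset1D ?eqxx ?Ab ?orbT.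
Qed.

Lemma holds_some_cons w a A : holds_some w (a +` A) <-> holds w a \/ holds_some w A.
Proof.
split=> [[b]|[wa|[b Ab wb]]].
- by rewrite in_mset1D => /predU1P[->|Ab]; [left | right; exists b].
- by exists a; rewrite // in_mset1D eqxx.
- by exists b; rewrite // in_mset1D Ab orbT.
Qed.

(** Two premises accommodate [orL]; one-premise rules take [H] and [K] equal. The hypothesis ranges
    over all worlds because the last part is evaluated at worlds reached through [G]. *)
Lemma holds_after (G : seq sequent) H K L :
    (forall w, holds_lns w H -> holds_lns w K -> holds_lns w L) ->
  forall w, holds_lns w (after G H) -> holds_lns w (after G K) ->
            holds_lns w (after G L).
Proof.
move=> HKL; elim: G => [|[A B] G IHG] w; [exact: HKL | move=> /= hH hK wA].
have [wB|hH'] := hH wA; first by left.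
have [wB|hK'] := hK wA; first by left.
by right=> v wv; apply: IHG; [apply: hH' | apply: hK'].
Qed.

Lemma holds_after_ax (G : seq sequent) H :
  (forall w, holds_lns w H) -> forall w, holds_lns w (after G H).
Proof. by move=> hH; elim: G => [|s G IHG] w //= _; right=> v _. Qed.

Hypothesis accT : transitive_model M.
Hypothesis accWF : conversely_wellfounded M.

(** By induction, every successor of [v] satisfies [a], since transitivity makes it a successor of
    [w]. Thus [Box a] holds at [v], and the hypothesis yields [a] there. *)
Lemma Loeb w a :
    (forall v, acc w v -> holds v (Box a) -> holds v a) -> holds w (Box a).
Proof.
move=> wa v; elim/(well_founded_ind accWF): v => v IHv wv.
by apply: (wa _ wv) => u vu; apply: IHv vu (accT wv vu).
Qed.

Lemma LNGL_holds H : LNGL H -> forall w, holds_lns w H.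
Proof.
elim=> {H} [G A B p|G A B a|G A B a b _ ha _ hb|G A B a b _ h|G A B a _ h
           |G A B a _ h|G A B C D a _ h|G A B C D a _ h|G A B a _ h] w.
- apply: holds_after_ax => {}w /= /holds_all_cons[wp _].
  by apply/holds_some_cons; left.
- apply: holds_after_ax => {}w /= /holds_all_cons[wa _].
  by apply/holds_some_cons; left.
- apply: holds_after (ha w) (hb w) => {ha hb}w /= ha hb.
  by case/holds_all_cons=> -[wa|wb] wA; [apply: ha | apply: hb]; apply/holds_all_cons.
- apply: holds_after (h w) (h w) => {h}w /= h _ /h.
  rewrite !holds_some_cons /=; tauto.
- apply: holds_after (h w) (h w) => {h}w /= h _ /holds_all_cons[na /h].
  by case/holds_some_cons=> // /na.
- apply: holds_after (h w) (h w) => {h}w /= h _ wA; apply/holds_some_cons.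
  have [wa|] := classic (holds w a); last by left.
  by right; apply: h; apply/holds_all_cons.
- apply: holds_after (h w) (h w) => {h}w /= h _ waA.
  have [wB|hC] := h waA; [by left | right=> v wv vC].
  apply: (hC v wv); apply/holds_all_cons; split=> // u vu.
  (* By transitivity [u] is also seen from [w], so [Box a] passes from [w] to its successor [v]. *)
  by case/holds_all_cons: waA => wa _; apply: wa (accT wv vu).
- apply: holds_after (h w) (h w) => {h}w /= h _ waA.
  have [wB|hC] := h waA; [by left | right=> v wv vC].
  apply: (hC v wv); apply/holds_all_cons; split=> //.
  by case/holds_all_cons: waA => wa _; apply: wa.
- apply: holds_after (h w) (h w) => {h}w /= h _ /h; rewrite holds_some_cons.
  case=> [wB|wa]; [by right | left].
  (* The last component of the premise, read at the successors of [w], is the hypothesis of [Loeb]: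
     both of its sides are singletons. *)
  apply: Loeb => v wv va.
  have [|b] := wa v wv; last by rewrite in_mset1 => /eqP->.
  by move=> b; rewrite in_mset1 => /eqP->.
Qed.

End Semantics.

Theorem theorem4p1 (G : lns) : LNGL G -> lns_valid G.
Proof. by move=> dG M accT accWF w; apply/holds_interp/LNGL_holds. Qed.
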